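(* Let $(\mathcal{A}_{LT,\eta})_{\eta\in(0,1)}$ be a family of oracle algorithms with the repetition guarantees (LT1)–(LT3) stated in the context. Suppose that $\mathcal{M}: D^n\to R\times\mathbb{R}$ is $\varepsilon$-DP, let $\gamma\in(0,1)$, and let $c>1$ be an integer. Let $\mathcal{A}$ be the algorithm that, on input $d$, runs $\mathcal{A}_{LT,\gamma^{1/c}}^{\mathcal{M}}(d)$ independently $c$ times and outputs, among the $c$ resulting tuples, one with the highest quality score. Then: (Privacy) $\mathcal{A}: D^n\to R\times\mathbb{R}$ is $3c\varepsilon$-DP. (Runtime) $\mathcal{A}$ on input $d$ makes in expectation $O\!\left(\frac{c}{\gamma^{1/c}}\right)$ calls to $\mathcal{M}$. (Utility) For every input $d$, $\Pr[\mathrm{val}(\mathcal{A}(d))\ge \mathrm{Median}(\mathrm{val}(\mathcal{M}(d)))]\ge 1-\gamma$.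
   Context: For a set $D$ and integer $n\ge1$, a dataset is an element of $D^n$; $d,d'$ are neighboring if they differ in exactly one entry. A randomized algorithm (mechanism) $\mathcal{M}$ on $D^n$ is $\varepsilon$-differentially private ($\varepsilon$-DP) if for all neighboring $d,d'$ and all (measurable) sets $S$ of outputs, $\Pr[\mathcal{M}(d)\in S]\le e^{\varepsilon}\Pr[\mathcal{M}(d')\in S]$. Mechanisms output a tuple $(o,v)\in R\times\mathbb{R}$, where $R$ is an arbitrary output space and $v$ is the quality score; $\mathrm{val}((o,v))=v$. $\mathrm{Median}(\mathrm{val}(\mathcal{M}(d)))=\sup\{z:\Pr_{(o,v)\sim\mathcal{M}(d)}[v\ge z]\ge \tfrac12\}$. An oracle algorithm run with oracle $\mathcal{M}$ may call $\mathcal{M}$ repeatedly, each call returning a fresh independent sample, and outputs one of the tuples it received. Probabilities and expectations are over the randomness of both the oracle algorithm and $\mathcal{M}$. Known guarantees (Liu–Talwar), to be taken as given: there is an absolute constant $C$ such that for every $\eta\in(0,1)$, every $\varepsilon>0$ and every $\varepsilon$-DP mechanism $\mathcal{M}:D^n\to R\times\mathbb{R}$: (LT1) $\mathcal{A}_{LT,\eta}^{\mathcal{M}}: D^n\to R\times\mathbb{R}$ is $3\varepsilon$-DP; (LT2) $\mathcal{A}_{LT,\eta}^{\mathcal{M}}$ on any input $d$ makes at most $C/\eta$ calls to $\mathcal{M}$ in expectation; (LT3) for every input $d$, $\Pr[\mathrm{val}(\mathcal{A}_{LT,\eta}^{\mathcal{M}}(d))\ge \mathrm{Median}(\mathrm{val}(\mathcal{M}(d)))]\ge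 1-\eta$. The constant in the $O(\cdot)$ of the claim is absolute (depends only on $C$). *)

(* Defs.v *)
From HB Require Import structures.
From mathcomp Require Import all_boot all_order all_algebra.
From mathcomp Require Import all_classical all_reals all_analysis.

Set Implicit Arguments.
Unset Strict Implicit.
Unset Printing Implicit Defensive.

Import Order.TTheory GRing.Theory Num.Theory.
Import numFieldNormedType.Exports.

Local Open Scope classical_set_scope.
Local Open Scope ring_scope.

(** Datasets are n-tuples over an arbitrary type D. *)
Definition neighbors (D : Type) (n : nat) (ds ds' : n.-tuple D) : Prop :=
  exists i : 'I_n, tnth ds i <> tnth ds' i /\
    forall j : 'I_n, j != i -> tnth ds j = tnth ds' j.

(** [law ds S] is the probability that the output on dataset [ds] lies in [S].
    A bare set function is accepted (rather than a [probability]) because the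
    output law of an oracle algorithm is only known to have total mass 1 once
    the algorithm is known to terminate almost surely. *)
Definition diff_private (RR : realType) (D : Type) (n : nat)
    (d : measure_display) (X : measurableType d)
    (eps : RR) (law : n.-tuple D -> set X -> \bar RR) : Prop :=
  forall ds ds' : n.-tuple D, neighbors ds ds' ->
  forall S : set X, measurable S ->
    (law ds S <= (expR eps)%:E * law ds' S)%E.

(** The quality score of [(o, v)] is [v]. *)
Definition val_median (RR : realType) (d : measure_display)
    (R : measurableType d) (mu : probability (R * RR)%type RR) : RR :=
  sup [set z : RR | ((2^-1)%:E <= mu [set x | z <= x.2]%R)%E].

Section iid.
Context (RR : realType) (d : measure_display) (X : measurableType d).

Definition cons_pair (k : nat) (p : X * k.-tuple X) : k.+1.-tuple X :=
  [tuple of p.1 :: p.2].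

Lemma measurable_cons_pair (k : nat) :
  measurable_fun [set: X * k.-tuple X] (@cons_pair k).
Proof. by apply: measurable_cons. Qed.

HB.instance Definition _ (k : nat) :=
  isMeasurableFun.Build _ _ _ _ (@cons_pair k) (@measurable_cons_pair k).

(** Law of [k] independent samples of [mu]. *)
Fixpoint iid (mu : probability X RR) (k : nat) :
    probability (k.-tuple X) RR :=
  match k with
  | 0 => dirac [tuple]
  | k'.+1 => distribution (mu \x iid mu k')%E (@cons_pair k')
  end.

End iid.

(** An algorithm with access to a sampling oracle. All of its internal
    randomness is drawn beforehand, as a seed [w] of law [seed_law]. Having
    received the answers [h] (in chronological order) on input [ds],
    it calls the oracle once more if [step ds w h = None], and halts with
    output [x] if [step ds w h = Some x]. *)
Record oracle_procedure (RR : realType) (D : Type) (n : nat) (X : Type) :=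
  OracleProcedure {
    seed_display : measure_display;
    seed : measurableType seed_display;
    seed_law : probability seed RR;
    step : n.-tuple D -> seed -> seq X -> option X
  }.

Section execution.
Context (RR : realType) (D : Type) (n : nat).
Context (d : measure_display) (X : measurableType d).
Implicit Type A : oracle_procedure RR D n X.

(** The output is one of the received answers, and the algorithm is
    measurable in the seed and the answers. *)
Definition oracle_algorithm A : Prop :=
  forall ds : n.-tuple D,
    (forall (w : seed A) (h : seq X) (x : X),
        step ds w h = Some x -> x \in h) /\
    (forall (k : nat) (S : set X), measurable S ->
        measurable [set wh : seed A * k.-tuple X |
          exists2 x, step ds wh.1 wh.2 = Some x & S x]).

(** With seed [w] and answers [h] to its first [size h] calls, the algorithm
    halts with output [x] after exactly [size h] calls. *)
Definition halts A (ds : n.-tuple D) (w : seed A) (h : seq X) (x : X) : Prop :=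
  (forall j : nat, (j < size h)%N -> step ds w (take j h) = None) /\
  step ds w h = Some x.

(** Probability that the execution on [ds], each call returning an independent
    sample of [mu], makes exactly [k] calls and outputs an element of [S]. *)
Definition halt_prob A (ds : n.-tuple D) (mu : probability X RR) (k : nat)
    (S : set X) : \bar RR :=
  (seed_law A \x iid mu k)%E [set wh : seed A * k.-tuple X |
    exists2 x, halts ds wh.1 wh.2 x & S x].

Definition output_law A (ds : n.-tuple D) (mu : probability X RR)
    (S : set X) : \bar RR :=
  (\sum_(0 <= k <oo) halt_prob A ds mu k S)%E.

(** The number of calls takes values in nat extended with infinity; it is
    infinite exactly when the execution does not halt. Recall that
    [+oo * 0 = 0]. *)
Definition expected_calls A (ds : n.-tuple D) (mu : probability X RR) :
    \bar RR :=
  (\sum_(0 <= k <oo) k%:R%:E * halt_prob A ds mu k setT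
   + +oo * (1 - output_law A ds mu setT))%E.

End execution.

Section repeated_runs.
Context (X : Type).

(** Feeds to [s] longer and longer prefixes of the answers, starting with
    [pre], until it halts; returns its output and the unused answers. *)
Fixpoint first_halt (s : seq X -> option X) (pre h : seq X) :
    option (X * seq X) :=
  match s pre with
  | Some x => Some (x, h)
  | None =>
      match h with
      | [::] => None
      | y :: h' => first_halt s (rcons pre y) h'
      end
  end.

(** Outputs of [c] successive runs of [s], the i-th one with the i-th seed and
    with the answers left over by its predecessors, so that every run gets
    fresh answers; [None] if [h] is too short to complete them all. *)
Fixpoint successive_runs (W : Type) (s : W -> seq X -> option X) (c : nat) :
    c.-tuple W -> seq X -> option (c.-tuple X) :=
  match c with
  | 0 => fun _ _ => Some [tuple]
  | c'.+1 => fun ws h =>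
      match first_halt (s (thead ws)) [::] h with
      | None => None
      | Some (x, h') =>
          omap (fun t : c'.-tuple X => [tuple of x :: t])
               (successive_runs s (behead_tuple ws) h')
      end
  end.

End repeated_runs.

(** Runs [A] [c] times, with independent seeds and fresh oracle answers, and
    then outputs the result of the run selected by [sel]. *)
Definition select_of_runs (RR : realType) (D : Type) (n : nat)
    (d : measure_display) (X : measurableType d)
    (A : oracle_procedure RR D n X) (c : nat) (sel : c.-tuple X -> 'I_c) :
    oracle_procedure RR D n X :=
  {| seed_law := iid (seed_law A) c;
     step := fun ds ws h =>
       omap (fun t => tnth t (sel t)) (successive_runs (@step _ _ _ _ A ds) ws h)
  |}.

(** A rule selecting a tuple with the highest quality score; ties are broken
    in an arbitrary measurable way. *)
Definition highest_score_rule (RR : realType) (d : measure_display)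
    (R : measurableType d) (c : nat)
    (sel : c.-tuple (R * RR)%type -> 'I_c) : Prop :=
  (forall (t : c.-tuple (R * RR)%type) (j : 'I_c),
      (tnth t j).2 <= (tnth t (sel t)).2) /\
  (forall i : 'I_c, measurable [set t | sel t = i]).

(** The guarantees of Liu and Talwar with constant [C]; [LT eta] is only
    constrained for [0 < eta < 1]. *)
Definition LT_guarantees (RR : realType) (C : RR) (D : Type) (n : nat)
    (d : measure_display) (R : measurableType d)
    (LT : RR -> oracle_procedure RR D n (R * RR)%type) : Prop :=
  forall eta : RR, 0 < eta < 1 ->
  forall eps : RR, 0 < eps ->
  forall M : n.-tuple D -> probability (R * RR)%type RR, diff_private eps M ->
  [/\ diff_private (3 * eps) (fun ds => output_law (LT eta) ds (M ds)),
      forall ds : n.-tuple D,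
        (expected_calls (LT eta) ds (M ds) <= (C / eta)%:E)%E
    & forall ds : n.-tuple D,
        ((1 - eta)%:E <=
          output_law (LT eta) ds (M ds) [set x | val_median (M ds) <= x.2]%R)%E].

(* Main.v *)
Require Import Defs.
From HB Require Import structures.
From mathcomp Require Import all_boot all_order all_algebra.
From mathcomp Require Import all_classical all_reals all_analysis.
From mathcomp Require Import measurable_realfun.

Import Order.TTheory GRing.Theory Num.Theory.
Import numFieldNormedType.Exports.

Local Open Scope classical_set_scope.
Local Open Scope ring_scope.

(** The law of one run of [LT eta] is [Q S = \sum_k P_k S], where [P_k S] is the
    probability of halting after exactly [k] oracle calls with an output in [S].
    Finiteness of the expected number of calls forces almost sure halting, so
    [Q] is a probability.

    [c.+1] successive runs halt after exactly [k] calls iff, for a unique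
    [i <= k], the first run halts on the first [i] answers and the [c] others
    halt on the remaining [k - i] ones. Seeds and answers being independent, the
    joint law of the outputs is a convolution over [i + j = k] which, summed
    over [k], is the product of [Q] with the law of [c] runs; inductively, the
    outputs of [c] runs are [c] independent samples of [Q], and the expected
    numbers of calls add up. Privacy follows since a bound [Q <= a Q'] on all
    events gives [Q^c <= a^c Q'^c] on all events, and utility since the best
    score is below the median only if all [c] scores are, which happens with
    probability at most [eta^c = gamma]. *)

Set Implicit Arguments.
Unset Strict Implicit.
Unset Printing Implicit Defensive.

(** * Splitting a tuple into two blocks, measurably *)

Section tuple_split.
Context (T : Type) (m n : nat).
Implicit Type t : (m + n).-tuple T.

Fact size_ltuple t : size (take m t) == m.
Proof. by rewrite size_takel// size_tuple leq_addr. Qed.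

Definition ltuple t : m.-tuple T := Tuple (size_ltuple t).

Fact size_rtuple t : size (drop m t) == n.
Proof. by rewrite size_drop size_tuple addKn. Qed.

Definition rtuple t : n.-tuple T := Tuple (size_rtuple t).

Lemma tnth_ltuple t i : tnth (ltuple t) i = tnth t (lshift n i).
Proof.
by rewrite (tnth_nth (tnth t (lshift n i))) [RHS](tnth_nth (tnth t (lshift n i)))
  nth_take.
Qed.

Lemma tnth_rtuple t i : tnth (rtuple t) i = tnth t (rshift m i).
Proof.
by rewrite (tnth_nth (tnth t (rshift m i))) [RHS](tnth_nth (tnth t (rshift m i)))
  nth_drop.
Qed.

End tuple_split.

Section measurable_tuple_split.
Context (d : measure_display) (T : measurableType d) (m n : nat).

Lemma measurable_ltuple : measurable_fun setT (@ltuple T m n).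
Proof.
apply/measurable_fun_tnthP => i.
rewrite (_ : _ \o _ = fun t => tnth t (lshift n i)); first exact: measurable_tnth.
by apply/funext => t /=; rewrite tnth_ltuple.
Qed.

Lemma measurable_rtuple : measurable_fun setT (@rtuple T m n).
Proof.
apply/measurable_fun_tnthP => i.
rewrite (_ : _ \o _ = fun t => tnth t (rshift m i)); first exact: measurable_tnth.
by apply/funext => t /=; rewrite tnth_rtuple.
Qed.

Lemma measurable_thead : measurable_fun setT (@thead n T).
Proof. exact: measurable_tnth. Qed.

Lemma measurable_behead_tuple :
  measurable_fun [set: n.+1.-tuple T] (fun t => behead_tuple t).
Proof.
rewrite (_ : (fun t => _) = fun t : n.+1.-tuple T => [tuple of behead t]).
  exact: measurable_behead.
by apply/funext => t; apply/val_inj.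
Qed.

End measurable_tuple_split.

(** * Independence of consecutive blocks of samples *)

Section iid_theory.
Context (RR : realType) (d : measure_display) (X : measurableType d).
Variable mu : probability X RR.

Lemma iidS k (A : set (k.+1.-tuple X)) :
  iid mu k.+1 A = (mu \x iid mu k)%E (@cons_pair _ _ k @^-1` A).
Proof. by []. Qed.

Lemma measurable_preimage_cons_pair k (A : set (k.+1.-tuple X)) :
  measurable A -> measurable (@cons_pair _ X k @^-1` A).
Proof. by move=> mA; rewrite -[X in measurable X]setTI; exact: measurable_cons_pair. Qed.

(** Induction on the first block: its leading sample is integrated out last, and the constant factor
    [iid mu k2 B] leaves the integral. For an empty block, the Dirac mass tests whether [A] contains
    the empty tuple. *)
Lemma iid_lrtuple k1 k2 (A : set (k1.-tuple X)) (B : set (k2.-tuple X)) :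
  measurable A -> measurable B ->
  iid mu (k1 + k2) [set t | A (ltuple t) /\ B (rtuple t)] =
  (iid mu k1 A * iid mu k2 B)%E.
Proof.
elim: k1 A => [A mA mB|k1 ih A mA mB].
  transitivity (iid mu k2 [set t | A [tuple] /\ B t]).
    congr (iid mu k2 _); apply/seteqP; split => t /=;
      rewrite (tuple0 (@ltuple X 0 k2 t));
      by (have -> : @rtuple X 0 k2 t = t by apply/val_inj; rewrite /= drop0).
  rewrite /= diracE; have [A0|A0] := pselect (A [tuple]).
    rewrite mem_set// mul1e; congr (iid mu k2 _).
    by apply/seteqP; split => t //= -[].
  rewrite memNset// mul0e (_ : [set t | _] = set0) ?measure0//.
  by apply/seteqP; split => t //= -[].
rewrite iidS.
transitivity (\int[mu]_x (iid mu k1 (xsection (@cons_pair _ _ k1 @^-1` A) x)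
   * iid mu k2 B))%E.
  apply: eq_integral => x _ /=.
  rewrite -ih//; last first.
    by apply: measurable_xsection; exact: measurable_preimage_cons_pair.
  have lE t : ltuple (cons_pair (x, t) : (k1.+1 + k2).-tuple X) = cons_pair (x, ltuple t).
    exact/val_inj.
  have rE t : rtuple (cons_pair (x, t) : (k1.+1 + k2).-tuple X) = rtuple t.
    exact/val_inj.
  by congr (iid mu _ _); apply/seteqP; split => t /=; rewrite /xsection/= !inE /= lE rE.
rewrite ge0_integralZr//.
by apply: measurable_fun_xsection; exact: measurable_preimage_cons_pair.
Qed.

End iid_theory.

Section seeded_iid.
Context (RR : realType) (d d' : measure_display).
Context (X : measurableType d) (W : measurableType d').
Variables (mu : probability X RR) (nu : probability W RR).

(** Independence of the first run from the later ones. For fixed seeds the answers factor by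
    [iid_lrtuple]; Tonelli then separates the first seed from the others. *)
Lemma seeded_iid_lrtuple k1 k2 c (A : set (W * k1.-tuple X))
    (B : set (c.-tuple W * k2.-tuple X)) :
  measurable A -> measurable B ->
  (iid nu c.+1 \x iid mu (k1 + k2))%E
    [set wh | A (thead wh.1, ltuple wh.2) /\ B (behead_tuple wh.1, rtuple wh.2)] =
  ((nu \x iid mu k1) A * (iid nu c \x iid mu k2) B)%E.
Proof.
move=> mA mB.
pose F (w : W) : \bar RR := iid mu k1 (xsection A w).
pose G (w : c.-tuple W) : \bar RR := iid mu k2 (xsection B w).
have mF : measurable_fun setT F by exact: measurable_fun_xsection.
have mG : measurable_fun setT G by exact: measurable_fun_xsection.
transitivity (\int[iid nu c.+1]_ws (F (thead ws) * G (behead_tuple ws)))%E.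
  apply: eq_integral => ws _ /=; rewrite /F /G -iid_lrtuple//.
  - congr (iid mu _ _); apply/seteqP; split => t /=;
      by rewrite /xsection/= !inE.
  - exact: measurable_xsection.
  - exact: measurable_xsection.
(* [iid nu c.+1] is by definition the image of a product under [cons_pair], so the integral moves to
   pairs of a seed and a tuple of seeds. *)
rewrite /= ge0_integral_pushforward//=.
- rewrite preimage_setT.
  transitivity (\int[nu \x iid nu c]_w (F w.1 * G w.2))%E.
    apply: eq_integral => -[w ws] _ /=; rewrite theadE.
    by congr (_ * G _)%E; exact/val_inj.
  rewrite fubini_tonelli1//=.
  + rewrite /fubini_F/=.
    transitivity (\int[nu]_w (F w * \int[iid nu c]_ws G ws))%E.
      by apply: eq_integral => w _; rewrite ge0_integralZl.
    by rewrite ge0_integralZr// integral_ge0.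
  + by apply: emeasurable_funM => //; exact: measurableT_comp.
  + by move=> w; rewrite mule_ge0.
- apply: emeasurable_funM; apply: measurableT_comp => //.
  + exact: measurable_thead.
  + exact: measurable_behead_tuple.
- by move=> w _; rewrite mule_ge0.
Qed.

Lemma seeded_iid_ltuple k1 k2 (A : set (W * k1.-tuple X)) :
  measurable A ->
  (nu \x iid mu (k1 + k2))%E [set wh | A (wh.1, ltuple wh.2)] =
  (nu \x iid mu k1)%E A.
Proof.
move=> mA; apply: eq_integral => w _ /=.
rewrite -[RHS]mule1 -(@probability_setT _ _ _ (iid mu k2)) -iid_lrtuple//.
- congr (iid mu _ _); apply/seteqP; split => t /=; rewrite /xsection/= !inE //.
  by case.
- exact: measurable_xsection.
Qed.

End seeded_iid.

(** * Measurable partial functions and their image measures *)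

Section partial_functions.
Context (Y Z : Type).
Implicit Type f : Y -> option Z.

Definition opreimage f (T : set Z) : set Y :=
  [set y | exists2 z, f y = Some z & T z].

Lemma opreimage0 f : opreimage f set0 = set0.
Proof. by apply/seteqP; split => y // -[]. Qed.

Lemma opreimage_bigcup f (F : nat -> set Z) :
  opreimage f (\bigcup_n F n) = \bigcup_n opreimage f (F n).
Proof.
by apply/seteqP; split => [y [z fz [n _ Fz]]|y [n _ [z fz Fz]]];
  [exists n => //; exists z|exists z => //; exists n].
Qed.

Lemma trivIset_opreimage f (F : nat -> set Z) :
  trivIset setT F -> trivIset setT (fun n => opreimage f (F n)).
Proof.
move=> /trivIsetP tF; apply/trivIsetP => i j _ _ ij.
apply/seteqP; split => // y [[z fz Fz] [z' fz' Fz']].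
have [zz'] : Some z = Some z' by rewrite -fz.
rewrite /set0/= -[False]/(set0 z) -(tF i j I I ij); split => //.
by rewrite zz'.
Qed.

End partial_functions.

Definition omeasurable (d d' : measure_display) (Y : measurableType d)
    (Z : measurableType d') (f : Y -> option Z) : Prop :=
  forall T : set Z, measurable T -> measurable (opreimage f T).

(** The domain of [f] is the preimage of a full rectangle, hence measurable. Off the domain, [f] is
    filled in with some value [z0] that it takes; the resulting total function is measurable because
    its two components are. *)
Lemma omeasurable_pair (d d' d'' : measure_display) (Y : measurableType d)
    (Z : measurableType d') (Z' : measurableType d'')
    (f : Y -> option (Z * Z')%type) :
  (forall A B, measurable A -> measurable B -> measurable (opreimage f (A `*` B))) ->
  omeasurable f.
Proof.
move=> mf T mT; have mD : measurable (opreimage f setT) by rewrite -setXTT; exact: mf.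
have [[y0 [z0 _ _]]|D0] := pselect (exists y, opreimage f setT y); last first.
  rewrite (_ : opreimage _ _ = set0)//; apply/seteqP; split => // y [z fz _].
  by apply: D0; exists y; exists z.
pose g y := odflt z0 (f y).
have preimage_g (A : set (Z * Z')) : measurable (opreimage f A) -> measurable (g @^-1` A).
  (* Points outside the domain are all sent to [z0]: they belong to the preimage all together, or
     not at all. *)
  move=> mA; rewrite (_ : _ @^-1` _ =
      opreimage f A `|` (~` opreimage f setT `&` [set _ | A z0])).
    apply: measurableU => //; apply: measurableI; first exact: measurableC.
    have [Az|Az] := pselect (A z0).
      by rewrite (_ : [set _ | _] = setT)//; apply/seteqP; split => ?.
    by rewrite (_ : [set _ | _] = set0)//; apply/seteqP; split => ?.
  apply/seteqP; split => [y /= |y /= ].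
    rewrite /g; case fy : (f y) => [z|] /= Az; first by left; exists z.
    by right; split => //; case=> z; rewrite fy.
  rewrite /g => -[[z -> Az]//|[]].
  by case fy : (f y) => [z|//] nz; case: nz; exists z.
have mg : measurable_fun setT g.
  rewrite (_ : g = fun y => ((g y).1, (g y).2)); last first.
    by apply/funext => ?; case: (g _).
  apply: measurable_fun_pair => _ A mA; rewrite setTI.
    by apply: (preimage_g [set z | A z.1]); rewrite -[X in opreimage f X]setXT; exact: mf.
  by apply: (preimage_g [set z | A z.2]); rewrite -[X in opreimage f X]setTX; exact: mf.
rewrite (_ : opreimage f T = opreimage f setT `&` g @^-1` T); last first.
  apply/seteqP; split => [y [z fz Tz]|y [[z fz _]]].
    by split; [exists z|rewrite /g /= fz].
  by rewrite /g /= fz => Tz; exists z.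
by apply: measurableI => //; rewrite -[X in measurable X]setTI; exact: mg.
Qed.

Section uncons_tuple.
Context (d : measure_display) (Z : measurableType d).

Definition uncons_tuple k (t : k.+1.-tuple Z) : Z * k.-tuple Z :=
  (thead t, behead_tuple t).

Lemma uncons_tupleK k :
  cancel (@uncons_tuple k) (@cons_pair _ Z k).
Proof. by move=> t; rewrite [t in RHS]tuple_eta; exact/val_inj. Qed.

Lemma opreimage_uncons (Y : Type) k
    (f : Y -> option (k.+1.-tuple Z)) T :
  opreimage f T = opreimage (fun y => omap (@uncons_tuple k) (f y))
                    (@cons_pair _ Z k @^-1` T).
Proof.
apply/seteqP; split => y /=.
  by move=> [t ft Tt]; exists (uncons_tuple t); rewrite ?ft//= uncons_tupleK.
move=> [p]; case ft : (f y) => [t|//] [<-] /=; rewrite uncons_tupleK => Tt.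
by exists t.
Qed.

End uncons_tuple.

Section partial_pushforward.
Local Open Scope ereal_scope.
Context (d d' : measure_display) (Y : measurableType d) (Z : measurableType d').
Context (RR : realType) (m : {measure set Y -> \bar RR}) (f : Y -> option Z).
Hypothesis mf : omeasurable f.

(** The proof of measurability is an argument so that the measure structure can be attached to the
    term itself. Mass outside the domain of [f] is lost. *)
Definition opushforward (_ : omeasurable f) (T : set Z) : \bar RR :=
  m (opreimage f T).

Let opushforward0 : opushforward mf set0 = 0.
Proof. by rewrite /opushforward opreimage0 measure0. Qed.

Let opushforward_ge0 T : 0 <= opushforward mf T.
Proof. exact: measure_ge0. Qed.

Let opushforward_sigma_additive : semi_sigma_additive (opushforward mf).
Proof.
move=> F mF tF mUF; rewrite /opushforward opreimage_bigcup.
apply: measure_semi_sigma_additive.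
- by move=> n; exact: mf.
- exact: trivIset_opreimage.
- by rewrite -opreimage_bigcup; exact: mf.
Qed.

HB.instance Definition _ := isMeasure.Build _ _ _
  (opushforward mf) opushforward0 opushforward_ge0 opushforward_sigma_additive.

End partial_pushforward.

(** * Halting times of one run and of successive runs *)

Section halting.
Context (W X Y : Type).
Implicit Type s : W -> seq X -> option Y.

(** The relation [halts] as a partial function, so that halting events become [opreimage]s. *)
Definition halting_output s (w : W) (h : seq X) : option Y :=
  if [forall j : 'I_(size h), ~~ s w (take j h)] then s w h else None.

Lemma halting_outputP s w h y : halting_output s w h = Some y <->
  (forall j, (j < size h)%N -> s w (take j h) = None) /\ s w h = Some y.
Proof.
rewrite /halting_output; split => [|[sN sy]].
  case: ifPn => // /forallP sN sy; split => // j jh.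
  by have := sN (Ordinal jh) => /=; case: (s w _).
by case: ifPn => // /forallPn[j]; rewrite sN.
Qed.

(** Halting on the shorter prefix contradicts the silence that the longer one demands of all its
    proper prefixes. This makes the events indexed by the halting time disjoint. *)
Lemma halting_output_uniq s w h i j y y' : (i <= size h)%N -> (j <= size h)%N ->
  halting_output s w (take i h) = Some y -> halting_output s w (take j h) = Some y' ->
  i = j.
Proof.
wlog ij : i j y y' / (i <= j)%N.
  move=> hw; case: (leqP i j) => [ij|/ltnW ij] ih jh hi hj; first exact: (hw i j y y').
  by apply/esym; apply: (hw j i y' y).
move=> ih jh /halting_outputP[_ si] /halting_outputP[sj _].
move: ij; rewrite leq_eqVlt => /predU1P[//|ij].
have ij' : (i < size (take j h))%N by rewrite size_takel.
by have := sj i ij'; rewrite take_takel ?si// ltnW.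
Qed.

End halting.

Section halting_of_runs.
Context (W X : Type) (s : W -> seq X -> option X).

(** The witness [k] is the number of answers consumed from [h]; [pre] is kept general for the
    induction. *)
Lemma first_haltP w pre h x h' :
  first_halt (s w) pre h = Some (x, h') <->
  exists k, [/\ (k <= size h)%N,
    forall j, (j < k)%N -> s w (pre ++ take j h) = None,
    s w (pre ++ take k h) = Some x & h' = drop k h].
Proof.
elim: h pre => [|y h ih] pre; last first.
  have -> : first_halt (s w) pre (y :: h) =
    if s w pre is Some z then Some (z, y :: h) else first_halt (s w) (rcons pre y) h by [].
  case sp : (s w pre) => [z|]; split => //.
  - by move=> [<- <-]; exists 0%N; rewrite take0 cats0.
  - move=> [[|k] [_ sN sk ->]]; first by move: sk; rewrite take0 cats0 sp drop0 => -[->].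
    by have := sN 0%N isT; rewrite take0 cats0 sp.
  - move=> /ih[k [kh sN sk ->]]; exists k.+1; split => //=.
      move=> [_|j jk]; first by rewrite take0 cats0.
      by rewrite -cat_rcons; exact: sN.
    by rewrite -cat_rcons.
  - move=> [[|k] [kh sN sk h'E]]; first by move: sk; rewrite take0 cats0 sp.
    apply/ih; exists k; split => //.
      by move=> j jk; rewrite cat_rcons; exact: (sN j.+1).
    by rewrite cat_rcons.
rewrite /=; case sp : (s w pre) => [z|]; split => //.
- by move=> [<- <-]; exists 0%N; rewrite cats0.
- by move=> [k [_ _]]; rewrite cats0 sp => -[->] ->.
- by move=> [k [_ _]]; rewrite cats0 sp.
Qed.

Lemma successive_runsS c (ws : c.+1.-tuple W) h t :
  successive_runs s ws h = Some t <->
  exists k, [/\ (k <= size h)%N,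
    halting_output s (thead ws) (take k h) = Some (thead t) &
    successive_runs s (behead_tuple ws) (drop k h) = Some (behead_tuple t)].
Proof.
rewrite /=; split.
  case fh : (first_halt _ _ _) => [[x h']|//].
  case rh : (successive_runs _ _ _) => [t'|//] [<-].
  move/first_haltP : fh => [k [kh sN sk h'E]]; exists k; split => //.
    apply/halting_outputP; rewrite size_takel// theadE; split => // j jk.
    by rewrite take_takel; [exact: sN|exact: ltnW].
  by rewrite -h'E rh; congr Some; exact/val_inj.
move=> [k [kh /halting_outputP[sN sk] rk]].
have -> : first_halt (s (thead ws)) [::] h = Some (thead t, drop k h).
  apply/first_haltP; exists k; split => // j jk.
  by rewrite -(sN j) ?size_takel// take_takel// ltnW.
by rewrite rk /=; congr Some; rewrite [t in RHS]tuple_eta; exact/val_inj.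
Qed.

Definition halting_runs c := halting_output (@successive_runs X W s c).

(** Unlike [successive_runsS], this asks that the answers be used up exactly. If the later runs
    completed on fewer answers, so would all the runs together, and conversely, since the first run
    can only stop at [k]. *)
Lemma halting_runsS c (ws : c.+1.-tuple W) h t :
  halting_runs ws h = Some t <->
  exists k, [/\ (k <= size h)%N,
    halting_output s (thead ws) (take k h) = Some (thead t) &
    halting_runs (behead_tuple ws) (drop k h) = Some (behead_tuple t)].
Proof.
split.
  move=> /halting_outputP[rN /successive_runsS[k [kh sk rk]]].
  exists k; split => //; apply/halting_outputP; split => // j jh.
  case rj : (successive_runs _ _ _) => [t'|//].
  have kjh : (k + j < size h)%N by rewrite -ltn_subRL -size_drop.
  have /successive_runsS : exists i, [/\ (i <= size (take (k + j) h))%N,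
      halting_output s (thead ws) (take i (take (k + j) h)) =
        Some (thead [tuple of thead t :: t']) &
      successive_runs s (behead_tuple ws) (drop i (take (k + j) h)) =
        Some (behead_tuple [tuple of thead t :: t'])].
    exists k; rewrite size_takel; last exact: ltnW.
    rewrite leq_addr take_takel ?leq_addr//; split => //.
    rewrite (addnC k j) -take_drop rj; congr Some; exact/val_inj.
  by rewrite rN.
move=> [k [kh sk /halting_outputP[rN rk]]]; apply/halting_outputP; split.
  move=> j jh; case rj : (successive_runs _ _ _) => [t'|//].
  move/successive_runsS : rj => [k' [k'j sk' rk']].
  have k'jj : (k' <= j)%N by rewrite (leq_trans k'j)// size_takel// ltnW.
  rewrite take_takel// in sk'.
  have k'k : k' = k.
    by apply: halting_output_uniq sk' sk => //; rewrite (leq_trans k'jj)// ltnW.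
  rewrite {}k'k in k'j sk' rk' k'jj; move: rk'.
  (* With [k' = k], the later runs would complete on only [j - k] of the answers left by the first
     run, which [rN] excludes. *)
  rewrite -{1}(subnK k'jj) -take_drop rN// size_drop.
  by rewrite ltn_sub2r// (leq_ltn_trans k'jj).
by apply/successive_runsS; exists k.
Qed.

End halting_of_runs.

(** * Measurability of halting, and rearrangement of double series *)

Lemma measurable_preimage_prod (d1 d2 e1 e2 : measure_display)
    (S1 : measurableType d1) (S2 : measurableType d2)
    (T1 : measurableType e1) (T2 : measurableType e2)
    (f : S1 -> T1) (g : S2 -> T2) (A : set (T1 * T2)) :
  measurable_fun setT f -> measurable_fun setT g -> measurable A ->
  measurable [set p | A (f p.1, g p.2)].
Proof.
move=> mf mg mA; have mfg : measurable_fun setT (fun p => (f p.1, g p.2)).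
  by apply: measurable_fun_pair; exact: measurableT_comp.
by rewrite -[X in measurable X]setTI; exact: mfg.
Qed.

(** Halting after [k] answers is a measurable event for [s], minus the finitely many events [S j] of
    having stopped earlier, each of which depends only on the first [j] answers. *)
Lemma omeasurable_halting_output (d d' d'' : measure_display)
    (W : measurableType d) (X : measurableType d') (Y : measurableType d'')
    (s : W -> seq X -> option Y) :
  (forall k, omeasurable (fun wh : W * k.-tuple X => s wh.1 wh.2)) ->
  forall k, omeasurable (fun wh : W * k.-tuple X => halting_output s wh.1 wh.2).
Proof.
move=> ms k T mT.
pose S (j : nat) := [set wh : W * k.-tuple X | s wh.1 (take j wh.2)].
rewrite (_ : opreimage _ T =
    opreimage (fun wh : W * k.-tuple X => s wh.1 wh.2) T
      `\` \big[setU/set0]_(j < k) S j); last first.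
  rewrite -bigcup_mkord; apply/seteqP; split => [[w h]|[w h]].
    move=> [y /= /halting_outputP[sN sy] Ty]; split; first by exists y.
    by move=> [j /= jk]; rewrite /S /= sN// size_tuple.
  move=> [[y /= sy Ty] sN]; exists y => //=; apply/halting_outputP; split => // j jh.
  case sj : (s w _) => [z|//]; case: sN; exists j; last by rewrite /S /= sj.
  by rewrite /= -(size_tuple h).
apply: measurableD; first exact: ms.
apply: bigsetU_measurable => -[j /= jk] _; rewrite {}/S.
(* Writing [k] as [j + l] lets the tuple type split into blocks. *)
move: (k - j)%N (subnKC (ltnW jk)) => l kE; subst k.
rewrite (_ : [set _ | _] = [set wh : W * (j + l).-tuple X |
    opreimage (fun wh : W * j.-tuple X => s wh.1 wh.2) setT
      (idfun wh.1, ltuple wh.2)]); last first.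
  apply/seteqP; split => [[w h]|[w h]] /=; last by move=> [z -> _].
  by case sj : (s w _) => [z|//] _; exists z.
apply: measurable_preimage_prod; [exact: measurable_id|exact: measurable_ltuple|exact: ms].
Qed.

(** The triangular sum is padded with zeros to a full double series [G], whose summations are
    interchanged and then shifted by [i]. *)
Lemma nneseries_convolution (RR : realType) (F : nat -> nat -> \bar RR) :
  (forall i j, 0 <= F i j)%E ->
  (\sum_(0 <= k <oo) \sum_(i < k.+1) F i (k - i)%N =
   \sum_(0 <= i <oo) \sum_(0 <= j <oo) F i j)%E.
Proof.
move=> F0; pose G k i : \bar RR := if (i <= k)%N then F i (k - i)%N else 0%E.
have G0 k i : (0 <= G k i)%E by rewrite /G; case: ifP.
transitivity (\sum_(0 <= k <oo) \sum_(0 <= i <oo) G k i)%E.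
  apply: eq_eseriesr => k _; rewrite (nneseries_split 0%N k.+1)// eseries0 ?adde0.
    by rewrite add0n big_mkord; apply: eq_bigr => i _; rewrite /G -ltnS ltn_ord.
  by move=> i ki _; rewrite /G leqNgt -ltnS ltnS; rewrite add0n in ki; rewrite ki.
rewrite nneseries_interchange//; apply: eq_eseriesr => i _.
rewrite (nneseries_split 0%N i)// add0n big1_seq ?add0e.
  rewrite -nneseries_addn//; apply: eq_eseriesr => j _.
  by rewrite /G leq_addl addnK.
by move=> k /andP[_]; rewrite mem_index_iota => /andP[_ ki]; rewrite /G leqNgt ki.
Qed.

Lemma nneseriesM (RR : realType) (a b : nat -> \bar RR) :
  (forall i, 0 <= a i)%E -> (forall i, a i \is a fin_num) ->
  (forall i, 0 <= b i)%E -> (\sum_(0 <= j <oo) b j)%E \is a fin_num ->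
  (\sum_(0 <= i <oo) \sum_(0 <= j <oo) a i * b j =
   (\sum_(0 <= i <oo) a i) * \sum_(0 <= j <oo) b j)%E.
Proof.
move=> a0 afin b0 bfin; rewrite -[X in (_ * X)%E]fineK// muleC -nneseriesZl//.
apply: eq_eseriesr => i _; rewrite -{1}(fineK (afin i)) nneseriesZl//.
by rewrite !fineK// muleC.
Qed.

(** * Joint law and expected number of calls of successive runs *)

Section law_of_runs.
Local Open Scope ereal_scope.
Context (RR : realType) (d d' : measure_display).
Context (X : measurableType d) (W : measurableType d').
Variables (mu : probability X RR) (nu : probability W RR).
Variable s : W -> seq X -> option X.
Hypothesis ms : forall k, omeasurable (fun wh : W * k.-tuple X => s wh.1 wh.2).

Let run k (wh : W * k.-tuple X) := halting_output s wh.1 wh.2.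
Let runs c k (wh : c.-tuple W * k.-tuple X) := halting_runs s wh.1 wh.2.
Let uruns c k (wh : c.+1.-tuple W * k.-tuple X) := omap (@uncons_tuple _ X c) (runs wh).

Let mrun k : omeasurable (@run k).
Proof. exact: omeasurable_halting_output. Qed.

(** [take] and [drop] allow any [i], without [k] having the form [i + l]; [stageE] recovers the
    typed blocks when it does. *)
Let stage c k (A : set X) (B : set (c.-tuple X)) i :=
  [set wh : c.+1.-tuple W * k.-tuple X |
    (exists2 x, halting_output s (thead wh.1) (take i wh.2) = Some x & A x) /\
    (exists2 t, halting_runs s (behead_tuple wh.1) (drop i wh.2) = Some t & B t)].

Let stageE c k1 k2 (A : set X) (B : set (c.-tuple X)) :
  @stage c (k1 + k2) A B k1 = [set wh |
    opreimage (@run k1) A (thead wh.1, ltuple wh.2) /\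
    opreimage (@runs c k2) B (behead_tuple wh.1, rtuple wh.2)].
Proof. by []. Qed.

Let opreimage_urunsX c k (A : set X) (B : set (c.-tuple X)) :
  opreimage (@uruns c k) (A `*` B) = \big[setU/set0]_(i < k.+1) stage A B i.
Proof.
rewrite -bigcup_mkord; apply/seteqP; split => -[ws h].
  move=> [[x t]]; rewrite /uruns/runs/=; case rh : (halting_runs _ _ _) => [t'|//].
  move=> [<- <-] [/= At Bt]; move/halting_runsS : rh => [i [ih si ri]].
  exists i; first by rewrite /= ltnS -(size_tuple h).
  by split => /=; [exists (thead t')|exists (behead_tuple t')].
move=> [i /= ik [[x /= sx Ax] [t /= rt Bt]]].
exists (x, t) => //; rewrite /uruns /runs /=.
have -> : halting_runs s ws h = Some (cons_pair (x, t)).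
  apply/halting_runsS; exists i; rewrite size_tuple; split => //.
    by rewrite rt; congr Some; exact/val_inj.
by rewrite /=; congr Some; apply: (congr2 pair); [exact: theadE|exact/val_inj].
Qed.

Let trivIset_stage c k (A : set X) (B : set (c.-tuple X)) :
  trivIset setT (fun i : 'I_k.+1 => @stage c k A B i).
Proof.
apply/trivIsetP => i j _ _; apply: contra_neqP => /eqP/set0P.
move=> [[ws h]] [[[x /= sx _] _] [[y /= sy _] _]].
apply/val_inj => /=; apply: halting_output_uniq sx sy.
- by rewrite size_tuple -ltnS.
- by rewrite size_tuple -ltnS.
Qed.

Let stage_measure c k i (A : set X) (B : set (c.-tuple X)) :
  (forall j, omeasurable (@runs c j)) -> measurable A -> measurable B -> (i <= k)%N ->
  measurable (@stage c k A B i) /\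
  (iid nu c.+1 \x iid mu k) (@stage c k A B i) =
  (nu \x iid mu i) (opreimage (@run i) A) *
  (iid nu c \x iid mu (k - i)) (opreimage (@runs c (k - i)) B).
Proof.
move=> mruns mA mB ik; move: (k - i)%N (subnKC ik) => l kE; subst k.
rewrite stageE seeded_iid_lrtuple; [split => //|exact: mrun|exact: mruns].
apply: measurableI; apply: measurable_preimage_prod.
- exact: measurable_thead.
- exact: measurable_ltuple.
- exact: mrun.
- exact: measurable_behead_tuple.
- exact: measurable_rtuple.
- exact: mruns.
Qed.

Let muruns c : (forall j, omeasurable (@runs c j)) -> forall k, omeasurable (@uruns c k).
Proof.
move=> mruns k; apply: omeasurable_pair => A B mA mB.
rewrite opreimage_urunsX; apply: bigsetU_measurable => i _.
by have [] := stage_measure mruns mA mB (ltn_ord i : i <= k)%N.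
Qed.

Lemma omeasurable_halting_runs c k :
  omeasurable (fun wh : c.-tuple W * k.-tuple X => halting_runs s wh.1 wh.2).
Proof.
elim: c k => [k T mT|c ih k T mT]; last first.
  rewrite opreimage_uncons; apply: (muruns ih).
  exact: measurable_preimage_cons_pair.
(* Zero runs are complete before any answer arrives, so they halt after exactly [k] answers only for
   [k = 0]. *)
have [k0|k0] := posnP k; last first.
  rewrite (_ : opreimage _ _ = set0)//; apply/seteqP; split => // -[ws h] [t /=].
  by move=> /halting_outputP[/(_ 0%N)]; rewrite size_tuple => /(_ k0).
subst k; have [Tt|Tt] := pselect (T [tuple]).
  rewrite (_ : opreimage _ _ = setT)//; apply/seteqP; split => // -[ws h] _.
  exists [tuple] => //; apply/halting_outputP; split => // j.
  by rewrite size_tuple.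
rewrite (_ : opreimage _ _ = set0)//; apply/seteqP; split => // -[ws h] [t _].
by rewrite (tuple0 t).
Qed.

(* [P k] and [J c k] are the output laws of one run and of [c] runs, restricted
   to the event that exactly [k] calls are made in total. *)
Let J c k := opushforward (iid nu c \x iid mu k) (@omeasurable_halting_runs c k).
Let P k := opushforward (nu \x iid mu k) (@mrun k).

Let J0 T : @J 0%N 0%N T = \d_([tuple] : 0.-tuple X) T.
Proof.
rewrite /J/= /opushforward diracE; have [Tt|Tt] := pselect (T [tuple]).
  rewrite mem_set// (_ : opreimage _ _ = setT) ?probability_setT//.
  apply/seteqP; split => // -[ws h] _.
  exists [tuple] => //; apply/halting_outputP; split => // j.
  by rewrite size_tuple.
rewrite memNset// (_ : opreimage _ _ = set0) ?measure0//.
by apply/seteqP; split => // -[ws h] [t _]; rewrite (tuple0 t).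
Qed.

Let J0S k T : @J 0%N k.+1 T = 0.
Proof.
rewrite /J/= /opushforward (_ : opreimage _ _ = set0) ?measure0//.
apply/seteqP; split => // -[ws h] [t /=].
by move=> /halting_outputP[/(_ 0%N)]; rewrite size_tuple => /(_ isT).
Qed.

Let opreimage_runsS c k U :
  opreimage (@runs c.+1 k) (@uncons_tuple _ X c @^-1` U) = opreimage (@uruns c k) U.
Proof.
rewrite opreimage_uncons; congr opreimage; apply/seteqP.
split => -[x t]; rewrite /= /uncons_tuple/= theadE;
  by (have -> : behead_tuple (cons_pair (x, t)) = t by exact/val_inj).
Qed.

(** The event is the disjoint union of its stages, and each stage has product probability. *)
Let JS c k A B : measurable A -> measurable B ->
  @J c.+1 k (@uncons_tuple _ X c @^-1` (A `*` B)) =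
  \sum_(i < k.+1) P i A * @J c (k - i) B.
Proof.
move=> mA mB; rewrite /J /P /opushforward.
rewrite opreimage_runsS.
have sl (i : 'I_k.+1) :=
  stage_measure (@omeasurable_halting_runs c) mA mB (ltn_ord i : i <= k)%N.
rewrite opreimage_urunsX measure_bigsetU_ord//.
- by apply: eq_bigr => i _; have [_] := sl i.
- by move=> i; have [] := sl i.
- exact: trivIset_stage.
Qed.

Definition run_law := mseries P 0.

(** The first [N] terms are the probabilities of disjoint events [E k] on the single space of a seed
    and [N] answers, so each partial sum is at most 1. *)
Lemma run_law_le1 : run_law setT <= 1.
Proof.
apply: lime_le; first by apply: is_cvg_nneseries => k _ _; exact: measure_ge0.
apply: nearW => N.
pose E k := [set wh : W * N.-tuple X | halting_output s wh.1 (take k wh.2)].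
have EP k : (k < N)%N ->
    measurable (E k) /\ P k setT = (nu \x iid mu N) (E k).
  move=> /ltnW kN; rewrite /E; move: (N - k)%N (subnKC kN) => l NE.
  clear E kN; subst N.
  have -> : [set wh : W * (k + l).-tuple X | halting_output s wh.1 (take k wh.2)] =
    [set wh : W * (k + l).-tuple X | opreimage (@run k) setT (wh.1, ltuple wh.2)].
    apply/seteqP; split => [[w h]|[w h]] /=; last by rewrite /opreimage /run /= => -[z ->].
    by case sk : (halting_output _ _ _) => [z|//] _; exists z.
  split; last by rewrite seeded_iid_ltuple//; exact: mrun.
  apply: (@measurable_preimage_prod _ _ _ _ _ _ _ _ idfun).
  - exact: measurable_id.
  - exact: measurable_ltuple.
  - exact: mrun.
rewrite big_mkord (eq_bigr (fun k : 'I_N => (nu \x iid mu N) (E k))); last first.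
  by move=> k _; have [] := EP k (ltn_ord k).
rewrite -measure_bigsetU_ord.
- by apply: probability_le1; apply: bigsetU_measurable => k _; have [] := EP k (ltn_ord k).
- by move=> k; have [] := EP k (ltn_ord k).
- apply/trivIsetP => i j _ _; apply: contra_neqP => /eqP/set0P[[w h] []].
  rewrite /E /=; case si : (halting_output _ _ _) => [x|//] _.
  case sj : (halting_output _ _ _) => [y|//] _.
  apply/val_inj => /=; apply: halting_output_uniq si sj.
  + by rewrite size_tuple ltnW.
  + by rewrite size_tuple ltnW.
Qed.

Section terminating.
Hypothesis run_law1 : run_law setT = 1.

HB.instance Definition _ := Measure.on run_law.
HB.instance Definition _ := Measure_isProbability.Build _ _ _ run_law run_law1.

(** A product measure is determined by its values on rectangles; there [JS] gives a convolution,
    whose sum over [k] is a product of two series. *)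
Lemma runs_law c T : measurable T ->
  \sum_(0 <= k <oo) @J c k T = iid run_law c T.
Proof.
elim: c T => [T mT|c ih T mT].
  rewrite nneseries_recl//= (J0 T) eseries0 ?adde0// => -[//|k] _ _; exact: J0S.
rewrite iidS.
(* The joint law of [c.+1] runs carried over to pairs, where it can be compared with a product
   measure. *)
pose m' := mseries (fun k => opushforward (iid nu c.+1 \x iid mu k)
  (@muruns c (@omeasurable_halting_runs c) k)) 0.
have m'J U : m' U = \sum_(0 <= k <oo) @J c.+1 k (@uncons_tuple _ X c @^-1` U).
  apply: eq_eseriesr => k _.
  exact: (congr1 (iid nu c.+1 \x iid mu k) (esym (opreimage_runsS k U))).
rewrite (product_measure_unique (m' := m')).
- apply: (etrans _ (esym (m'J _))).
  rewrite (_ : _ @^-1` (_ @^-1` T) = T)//.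
  by apply/seteqP; split => t; rewrite /= uncons_tupleK.
- move=> A B mA mB; apply: (etrans (m'J _)).
  under eq_eseriesr do rewrite JS//.
  rewrite (nneseries_convolution (F := fun i j => P i A * @J c j B)); last first.
    by move=> i j; rewrite mule_ge0.
  apply: (etrans _ (congr1 (fun x => run_law A * x) (ih B mB))).
  rewrite nneseriesM//.
  - move=> i; rewrite ge0_fin_numE//.
    exact: le_lt_trans (probability_le1 (nu \x iid mu i) (mrun mA)) (ltry 1).
  - by rewrite ih// fin_num_measure.
- exact: measurable_preimage_cons_pair.
Qed.

Definition run_probability : probability X RR := run_law.

(** In the convolution, [k] splits as [i + (k - i)]: each part is weighted by the total mass 1 of
    the other factor, so the expectations [e] and [c * e] add up. *)
Lemma expected_calls_runs c (e : RR) :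
  \sum_(0 <= k <oo) k%:R%:E * P k setT = e%:E ->
  \sum_(0 <= k <oo) k%:R%:E * @J c k setT = (c%:R * e)%:E.
Proof.
move=> Pe; elim: c => [|c ih].
  rewrite eseries0 ?mul0r// => -[|k] _ _; first by rewrite mul0e.
  by rewrite (J0S k setT) mule0.
have Pfin k : P k setT \is a fin_num.
  rewrite ge0_fin_numE//.
  exact: le_lt_trans (probability_le1 (nu \x iid mu k) (mrun measurableT)) (ltry 1).
have J1 : \sum_(0 <= k <oo) @J c k setT = 1 by rewrite runs_law// probability_setT.
pose F i j : \bar RR :=
  i%:R%:E * P i setT * @J c j setT + P i setT * (j%:R%:E * @J c j setT).
have F0 i j : 0 <= F i j.
  by apply: adde_ge0; rewrite ?mule_ge0// lee_fin.
transitivity (\sum_(0 <= k <oo) \sum_(i < k.+1) F i (k - i)%N).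
  apply: eq_eseriesr => k _.
  (* The full set is presented as a rectangle so that [JS] applies. *)
  have /esym/(congr1 (@J c.+1 k)) ->: @uncons_tuple _ X c @^-1` (setT `*` setT) = setT.
    by rewrite setXTT.
  rewrite JS// ge0_sume_distrr//; last by move=> i _; rewrite mule_ge0.
  apply: eq_bigr => i _; rewrite /F -!muleA (muleCA (P i setT)) -ge0_muleDl ?lee_fin//.
  by rewrite -EFinD -natrD subnKC// -ltnS.
rewrite nneseries_convolution//.
transitivity (\sum_(0 <= i <oo) (\sum_(0 <= j <oo) i%:R%:E * P i setT * @J c j setT +
    \sum_(0 <= j <oo) P i setT * (j%:R%:E * @J c j setT))).
  by apply: eq_eseriesr => i _; rewrite nneseriesD// => j _ _; rewrite !mule_ge0// lee_fin.
rewrite nneseriesD; last 2 first.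
- by move=> i _ _; apply: nneseries_ge0 => j _ _; rewrite !mule_ge0// lee_fin.
- by move=> i _ _; apply: nneseries_ge0 => j _ _; rewrite !mule_ge0// lee_fin.
rewrite nneseriesM ?J1//; last 2 first.
- by move=> i; rewrite mule_ge0// lee_fin.
- by move=> i; rewrite fin_numM.
rewrite nneseriesM ?ih//; last by move=> i; rewrite mule_ge0// lee_fin.
rewrite Pe mule1 -/run_law.
have -> : \sum_(0 <= k <oo) P k setT = 1 by exact: run_law1.
by rewrite mul1e -EFinD -natr1 mulrDl mul1r addrC.
Qed.

End terminating.
End law_of_runs.

(** * Bounds on laws of independent samples *)

Section iid_bounds.
Context (RR : realType) (d : measure_display) (X : measurableType d).

(** One sample at a time: induction bounds the sections inside the integral, then [mu] is replaced
    by the larger measure [a mu']. This is composition of privacy for independent runs. *)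
Lemma iid_le (mu mu' : probability X RR) (a : RR) : 0 <= a ->
  (forall S, measurable S -> (mu S <= a%:E * mu' S)%E) ->
  forall c S, measurable S -> (iid mu c S <= (a ^+ c)%:E * iid mu' c S)%E.
Proof.
move=> a0 mule c; elim: c => [S mS|c ih S mS]; first by rewrite expr0 mul1e.
rewrite !iidS; set T := _ @^-1` S.
have mT : measurable T by exact: measurable_preimage_cons_pair.
have mF : measurable_fun setT ((iid mu' c \o xsection T) : X -> \bar RR).
  exact: measurable_fun_xsection.
apply: (@le_trans _ _ (\int[mu]_x ((a ^+ c)%:E * iid mu' c (xsection T x)))%E).
  apply: ge0_le_integral => //=.
  - exact: measurable_fun_xsection.
  - exact: (measurable_funeM _ mF).
  - by move=> x _; apply: ih; exact: measurable_xsection.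
rewrite ge0_integralZl//; last by rewrite lee_fin exprn_ge0.
rewrite exprSr EFinM -muleA lee_wpmul2l ?lee_fin ?exprn_ge0//.
apply: (@le_trans _ _ (\int[mscale (NngNum a0) mu']_x iid mu' c (xsection T x))%E).
  exact: ge0_le_measure_integral.
by rewrite ge0_integral_mscale.
Qed.

Lemma measurable_all_tuple (B : set X) c : measurable B ->
  measurable [set t : c.-tuple X | forall i, B (tnth t i)].
Proof.
move=> mB; rewrite (_ : [set _ | _] =
    \bigcap_(i in [set: 'I_c]) ((tnth (T:=X))^~ i @^-1` B)).
  apply: fin_bigcap_measurable => [|i _]; first exact: finite_finset.
  by rewrite -[X in measurable X]setTI; exact: measurable_tnth.
by apply/seteqP; split => t /= Bt i; [move=> _; exact: Bt|exact: (Bt i I)].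
Qed.

Lemma iid_all_le (mu : probability X RR) (B : set X) (b : RR) c : 0 <= b ->
  measurable B -> (mu B <= b%:E)%E ->
  (iid mu c [set t | forall i, B (tnth t i)] <= (b ^+ c)%:E)%E.
Proof.
move=> b0 mB muB; elim: c => [|c ih].
  by rewrite expr0 probability_le1//; exact: measurable_all_tuple.
rewrite iidS (_ : _ @^-1` _ =
    B `*` [set t : c.-tuple X | forall i, B (tnth t i)]); last first.
  apply/seteqP; split => -[x t] /=.
    move=> Bt; split => [|i]; first by have := Bt ord0.
    by have := Bt (lift ord0 i); rewrite tnthS.
  move=> [Bx Bt] i; case: (unliftP ord0 i) => [j ->|->] //.
  by rewrite tnthS; exact: Bt.
rewrite product_measure1E//; last exact: measurable_all_tuple.
by rewrite exprS EFinM lee_pmul.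
Qed.

End iid_bounds.

(** * From abstract runs back to oracle procedures *)

Section halt_probabilities.
Context (RR : realType) (D : Type) (n : nat).
Context (d : measure_display) (X : measurableType d).
Implicit Types (A : oracle_procedure RR D n X) (ds : n.-tuple D).
Implicit Type mu : probability X RR.

Lemma halt_probE A ds mu k S : halt_prob A ds mu k S =
  (seed_law A \x iid mu k)%E
    (opreimage (fun wh : seed A * k.-tuple X => halting_output (step ds) wh.1 wh.2) S).
Proof.
apply: (congr1 (seed_law A \x iid mu k)%E).
apply/seteqP; split => -[w h] [x hx Sx]; exists x => //;
  exact/halting_outputP.
Qed.

(** Selecting one of the outputs leaves the halting time unchanged. *)
Lemma halt_prob_select A ds mu c (sel : c.-tuple X -> 'I_c) k S :
  halt_prob (select_of_runs A sel) ds mu k S =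
  (iid (seed_law A) c \x iid mu k)%E
    (opreimage (fun wh : c.-tuple (seed A) * k.-tuple X =>
         halting_runs (@step _ _ _ _ A ds) wh.1 wh.2)
       [set t | S (tnth t (sel t))]).
Proof.
rewrite halt_probE; apply: (congr1 (iid (seed_law A) c \x iid mu k)%E).
apply/seteqP; split => -[ws h].
  move=> [x /halting_outputP[rN]] /=.
  case rh : (successive_runs _ _ _) => [t|//] [<-] St; exists t => //.
  apply/halting_outputP; split => // j /rN /=.
  by case: (successive_runs _ _ _).
move=> [t /halting_outputP[rN rh] St]; exists (tnth t (sel t)) => //.
by apply/halting_outputP; split => [j /rN /= ->//|] /=; rewrite rh.
Qed.

End halt_probabilities.

Section oracle_algorithms.
Local Open Scope ereal_scope.
Context (RR : realType) (D : Type) (n : nat).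
Context (d : measure_display) (X : measurableType d).
Variables (A : oracle_procedure RR D n X) (ds : n.-tuple D) (mu : probability X RR).
Hypothesis oA : oracle_algorithm A.
Hypothesis calls_fin : expected_calls A ds mu < +oo.

Let ms k : omeasurable (fun wh : seed A * k.-tuple X => step ds wh.1 wh.2).
Proof. by move=> S mS; have [_] := oA ds; apply. Qed.

Let output_lawE S : output_law A ds mu S = run_law mu (seed_law A) ms S.
Proof. by apply: eq_eseriesr => k _; rewrite halt_probE. Qed.

Let halt_prob_ge0 k S : 0 <= halt_prob A ds mu k S.
Proof. exact: measure_ge0. Qed.

Lemma output_law1 : output_law A ds mu setT = 1.
Proof.
apply/eqP; rewrite eq_le output_lawE run_law_le1/= -output_lawE leNgt.
apply/negP => lt1; move: calls_fin; rewrite /expected_calls.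
(* A positive probability of not halting would contribute [+oo] to the expected number of calls. *)
rewrite gt0_mulye; last by rewrite sube_gt0.
rewrite addey ?ltxx// -ltNye (@lt_le_trans _ _ 0) ?ltNy0//.
by apply: nneseries_ge0 => k _ _; rewrite mule_ge0// lee_fin.
Qed.

Let law1 : run_law mu (seed_law A) ms setT = 1.
Proof. by rewrite -output_lawE output_law1. Qed.

Lemma output_law_select : exists Q : probability X RR,
  (forall S, output_law A ds mu S = Q S) /\
  (forall c (sel : c.-tuple X -> 'I_c) S,
     measurable [set t | S (tnth t (sel t))] ->
     output_law (select_of_runs A sel) ds mu S =
     iid Q c [set t | S (tnth t (sel t))]).
Proof.
exists (run_probability law1); split; first exact: output_lawE.
move=> c sel S mS; apply: etrans (runs_law law1 mS).
by apply: eq_eseriesr => k _; rewrite halt_prob_select.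
Qed.

Lemma expected_calls_select c (sel : c.-tuple X -> 'I_c) :
  expected_calls (select_of_runs A sel) ds mu = c%:R%:E * expected_calls A ds mu.
Proof.
have [Q [_ lawS]] := output_law_select.
have EA : expected_calls A ds mu = \sum_(0 <= k <oo) k%:R%:E * halt_prob A ds mu k setT.
  by rewrite /expected_calls output_law1 subee// mule0 adde0.
have E0 : 0 <= \sum_(0 <= k <oo) k%:R%:E * halt_prob A ds mu k setT.
  by apply: nneseries_ge0 => k _ _; rewrite mule_ge0// lee_fin.
have law_select1 : output_law (select_of_runs A sel) ds mu setT = 1.
  by rewrite (lawS c sel setT measurableT); exact: probability_setT.
rewrite {1}/expected_calls law_select1 subee// mule0 adde0.
move: calls_fin E0; rewrite EA.
(* Finiteness of the calls excludes [+oo] and nonnegativity excludes [-oo]. *)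
case E : (\sum_(0 <= k <oo) _) => [e| |]// _ _.
rewrite -EFinM -(expected_calls_runs law1 _ (e := e)).
  by apply: eq_eseriesr => k _; rewrite halt_prob_select.
by rewrite -E; apply: eq_eseriesr => k _; rewrite halt_probE.
Qed.

End oracle_algorithms.

(** * Privacy, runtime and utility of the best of several runs *)

Lemma measurable_select (d : measure_display) (X : measurableType d) c
    (sel : c.-tuple X -> 'I_c) S :
  (forall i, measurable [set t | sel t = i]) -> measurable S ->
  measurable [set t | S (tnth t (sel t))].
Proof.
move=> msel mS; rewrite (_ : [set _ | _] =
    \bigcup_(i in [set: 'I_c]) ([set t | sel t = i] `&` (tnth (T:=X))^~ i @^-1` S)).
  apply: fin_bigcup_measurable => [|i _]; first exact: finite_finset.
  apply: measurableI => //; rewrite -[X in measurable X]setTI.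
  exact: measurable_tnth.
apply/seteqP; split => t /=; first by exists (sel t).
by move=> [i _ [/= ->]].
Qed.

Theorem mainTheorem3 (RR : realType) (C : RR) :
  exists K : RR,
  forall (D : Type) (n : nat) (dR : measure_display) (R : measurableType dR)
    (LT : RR -> oracle_procedure RR D n (R * RR)%type)
    (eps : RR) (M : n.-tuple D -> probability (R * RR)%type RR)
    (gamma : RR) (c : nat) (sel : c.-tuple (R * RR)%type -> 'I_c),
  (1 <= n)%N ->
  (forall eta : RR, 0 < eta < 1 -> oracle_algorithm (LT eta)) ->
  LT_guarantees C LT ->
  0 < eps -> diff_private eps M ->
  0 < gamma < 1 ->
  (1 < c)%N ->
  highest_score_rule sel ->
  let A := select_of_runs (LT (gamma `^ (c%:R^-1))) sel in
  [/\ diff_private (3 * c%:R * eps) (fun ds => output_law A ds (M ds)),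
      forall ds : n.-tuple D,
        (expected_calls A ds (M ds) <= (K * (c%:R / gamma `^ (c%:R^-1)))%:E)%E
    & forall ds : n.-tuple D,
        ((1 - gamma)%:E <=
          output_law A ds (M ds) [set x | val_median (M ds) <= x.2]%R)%E].

Proof.
(* The expected number of calls is exactly [c] times that of one run, so the constant [C] itself
   serves as [K]. *)
exists C => D n dR R LT eps M gamma c sel n1 oLT LTG eps0 Mpriv /andP[g0 g1] c1.
move=> [selmax msel].
set eta := gamma `^ c%:R^-1; move=> A.
have c0 : 0 < c%:R :> RR by rewrite ltr0n ltnW.
have eta0 : 0 < eta by exact: powR_gt0.
have eta1 : eta < 1.
  have -> : 1 = 1 `^ c%:R^-1 :> RR by rewrite powR1.
  by rewrite gt0_ltr_powR ?invr_gt0 ?nnegrE// ltW.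
have etac : eta ^+ c = gamma.
  by rewrite -powR_mulrn ?ltW// -powRrM mulVf ?gt_eqF// powRr1 ?ltW.
have eta01 : 0 < eta < 1 by rewrite eta0.
have [priv calls util] := LTG eta eta01 eps eps0 M Mpriv.
have oA := oLT eta eta01.
have fin ds := le_lt_trans (calls ds) (ltry _).
split.
- move=> ds ds' nb S mS.
  have [Q [QE QS]] := output_law_select oA (fin ds).
  have [Q' [QE' QS']] := output_law_select oA (fin ds').
  have mT := measurable_select msel mS.
  rewrite QS// QS'//.
  rewrite (_ : expR _ = expR (3 * eps) ^+ c); last first.
    by rewrite -expRM_natl; congr expR; rewrite -mulrA mulrCA.
  apply: iid_le => //.
  by move=> U mU; rewrite -QE -QE'; exact: priv.
- move=> ds; rewrite expected_calls_select//.
  apply: le_trans (lee_wpmul2l _ (calls ds)) _; first by rewrite lee_fin.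
  by rewrite -EFinM lee_fin mulrCA.
- move=> ds; set m := val_median _.
  have [Q [QE QS]] := output_law_select oA (fin ds).
  pose G := [set x : R * RR | m <= x.2].
  have mG : measurable G.
    rewrite (_ : G = snd @^-1` `[m, +oo[%classic); last first.
      by apply/seteqP; split => x /=; rewrite in_itv/= andbT.
    by rewrite -[X in measurable X]setTI; exact: measurable_snd.
  have mT := measurable_select msel mG.
  have mB : measurable (~` G) by exact: measurableC.
  rewrite QS//.
  (* The complementary form of the utility guarantee for one run. *)
  have QB : (Q (~` G) <= eta%:E)%E.
    rewrite probability_setC// leeBlDl ?fin_num_measure//.
    rewrite -leeBlDr ?fin_num_measure// -QE; exact: util.
  have := iid_all_le c (ltW eta0) mB QB; rewrite etac => allB.
  have mall := measurable_all_tuple (c := c) mB.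
  (* Some score reaches the median unless all [c] of them miss it; the selected score is at least as
     large as that one. *)
  apply: (@le_trans _ _ (iid Q c (~` [set t : c.-tuple (R * RR)%type |
      forall i, (~` G) (tnth t i)]))).
    rewrite probability_setC// EFinB; exact: leeB.
  apply: le_measure; rewrite ?inE//; first exact: measurableC.
  move=> t /= /existsNP[i /contrapT]; rewrite /G /= => mi.
  exact: le_trans mi (selmax t i).
Qed.
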